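(* Let $R$ be a commutative Noetherian ring, $N \subseteq M$ finitely generated $R$-modules, $X \subseteq \mathrm{Spec}(R)$ a basic set, and $\mathscr{E}$ an $R$-submodule of $\mathrm{Hom}_R(M,R)$. Assume that for each $\mathfrak{p} \in X$, $N_\mathfrak{p}$ contains a free $R_\mathfrak{p}$-submodule $F(\mathfrak{p})$ of rank at least $1 + \dim_X(\mathfrak{p})$ that is a free $\mathscr{E}_\mathfrak{p}$-summand of $M_\mathfrak{p}$. Then there exists $x \in N$ that is $X$-free-basic for $M$ with respect to $\mathscr{E}$. Moreover, if an element $(a,y) \in R \oplus N$ is $X$-free-basic for $R \oplus M$ with respect to $R \oplus \mathscr{E}$, then $x$ can be chosen of the form $x = y + az$ for some $z \in N$.
   Context: A subset $X \subseteq \mathrm{Spec}(R)$ is basic if, whenever the intersection of a family of primes in $X$ is a prime ideal, that intersection belongs to $X$. For $\mathfrak{p} \in X$, $\dim_X(\mathfrak{p})$ is the supremum of the lengths $n$ of chains $\mathfrak{p} = \mathfrak{p}_0 \subsetneq \cdots \subsetneq \mathfrak{p}_n$ in $X$. For an $R$-submodule $\mathscr{E} \subseteq \mathrm{Hom}_R(M,R)$, $\mathscr{E}_\mathfrak{p}$ is viewed inside $\mathrm{Hom}_{R_\mathfrak{p}}(M_\mathfrak{p},R_\mathfrak{p})$. A free $\mathscr{E}_\mathfrak{p}$-summand of $M_\mathfrak{p}$ is a direct summand $F$ of $M_\mathfrak{p}$ (with complement $G$) with $F \cong R_\mathfrak{p}^n$ such that each coordinate of the projection $M_\mathfrak{p}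 \to F \cong R_\mathfrak{p}^n$ along $G$ lies in $\mathscr{E}_\mathfrak{p}$. An element $x \in M$ is $\mathfrak{p}$-free-basic for $M$ with respect to $\mathscr{E}$ if $(Rx)_\mathfrak{p} \cong R_\mathfrak{p}$ and the inclusion $(Rx)_\mathfrak{p} \subseteq M_\mathfrak{p}$ splits via an element of $\mathscr{E}_\mathfrak{p}$ (i.e. some $\varphi \in \mathscr{E}_\mathfrak{p}$ has $\varphi(x/1) = 1$); it is $X$-free-basic with respect to $\mathscr{E}$ if it is $\mathfrak{p}$-free-basic with respect to $\mathscr{E}$ for every $\mathfrak{p} \in X$. Here $R \oplus \mathscr{E}$ is regarded as the $R$-submodule of $\mathrm{Hom}_R(R \oplus M, R)$ consisting of the maps $(r,m) \mapsto cr + f(m)$ with $c \in R$, $f \in \mathscr{E}$. *)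

(* Defs.v *)
From HB Require Import structures.
From mathcomp Require Import all_boot all_order all_algebra.
Set Implicit Arguments. Unset Strict Implicit. Unset Printing Implicit Defensive.
Import GRing.Theory.
Local Open Scope ring_scope.

Section Ring.
Variable R : comPzRingType.

Definition is_ideal (I : R -> Prop) : Prop :=
  [/\ I 0, (forall a b, I a -> I b -> I (a + b)) & (forall r a, I a -> I (r * a))].

Definition is_prime_ideal (P : R -> Prop) : Prop :=
  [/\ is_ideal P, ~ P 1 & (forall a b, P (a * b) -> P a \/ P b)].

Definition noetherian_ring : Prop :=
  forall I : R -> Prop, is_ideal I ->
    exists s : seq R, forall r, I r <->
      exists c : 'I_(size s) -> R, r = \sum_(i < size s) c i * s`_i.

Definition bigcap_ideals (F : (R -> Prop) -> Prop) : R -> Prop :=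
  fun r => forall q, F q -> q r.

Definition subset_Spec (X : (R -> Prop) -> Prop) : Prop :=
  forall q, X q -> is_prime_ideal q.

Definition basic_set (X : (R -> Prop) -> Prop) : Prop :=
  forall F : (R -> Prop) -> Prop, (forall q, F q -> X q) ->
    is_prime_ideal (bigcap_ideals F) -> X (bigcap_ideals F).

Definition strict_incl (P Q : R -> Prop) : Prop :=
  (forall r, P r -> Q r) /\ exists r, Q r /\ ~ P r.

Definition chain_in (X : (R -> Prop) -> Prop) (p : R -> Prop) (n : nat)
    (c : nat -> (R -> Prop)) : Prop :=
  [/\ c 0%N = p, (forall i, (i <= n)%N -> X (c i))
    & (forall i, (i < n)%N -> strict_incl (c i) (c i.+1))].

(* rank >= 1 + dim_X(p), where dim_X(p) is the supremum of the lengths of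
   chains in X starting at p (possibly infinite) *)
Definition one_plus_dimX_le (X : (R -> Prop) -> Prop) (p : R -> Prop)
    (rk : nat) : Prop :=
  forall n c, chain_in X p n c -> (n + 1 <= rk)%N.

(* Localization at a prime p, via fractions.  An element a/s of R_p is the
   pair (a, s) with ~ p s. *)
Definition req (p : R -> Prop) (x y : R * R) : Prop :=
  exists u, ~ p u /\ u * (x.1 * y.2 - y.1 * x.2) = 0.

End Ring.

Section Module.
Variables (R : comPzRingType) (V : lmodType R).

Definition is_submodule (N : V -> Prop) : Prop :=
  [/\ N 0, (forall u v, N u -> N v -> N (u + v)) & (forall r v, N v -> N (r *: v))].

Definition fin_gen_in (N : V -> Prop) : Prop :=
  exists s : seq V, (forall i, (i < size s)%N -> N s`_i) /\
    forall v, N v -> exists c : 'I_(size s) -> R, v = \sum_(i < size s) c i *: s`_i.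

Definition fin_gen_module : Prop := fin_gen_in (fun _ => True).

Definition is_dual_submodule (E : (V -> R) -> Prop) : Prop :=
  [/\ (forall f, E f -> forall r u v, f (r *: u + v) = r * f u + f v),
      E (fun _ => 0),
      (forall f g, E f -> E g -> E (fun v => f v + g v))
    & (forall r f, E f -> E (fun v => r * f v))].

(* Elements v/s of V_p are pairs (v, s) with ~ p s *)
Definition leq_frac (p : R -> Prop) (x y : V * R) : Prop :=
  exists u, ~ p u /\ u *: (y.2 *: x.1 - x.2 *: y.1) = 0.

Definition fadd (x y : V * R) : V * R := (y.2 *: x.1 + x.2 *: y.1, x.2 * y.2).
Definition fopp (x : V * R) : V * R := (- x.1, x.2).
Definition fzero : V * R := (0, 1).
Definition fscale (a : R * R) (x : V * R) : V * R := (a.1 *: x.1, a.2 * x.2).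
Definition fsum n (F : 'I_n -> V * R) : V * R := \big[fadd/fzero]_(i < n) F i.
(* the element f/s of E_p (f in E) evaluated at v/t in V_p: f(v)/(st) in R_p *)
Definition feval (phi : (V -> R) * R) (x : V * R) : R * R :=
  (phi.1 x.1, phi.2 * x.2).

Definition in_loc (p : R -> Prop) (G : V * R -> Prop) (x : V * R) : Prop :=
  exists g, [/\ G g, ~ p g.2 & leq_frac p g x].

Definition loc_submodule (p : R -> Prop) (G : V * R -> Prop) : Prop :=
  [/\ in_loc p G fzero,
      (forall x y, ~ p x.2 -> ~ p y.2 -> in_loc p G x -> in_loc p G y ->
         in_loc p G (fadd x y))
    & (forall a x, ~ p a.2 -> ~ p x.2 -> in_loc p G x -> in_loc p G (fscale a x))].

(* N_p contains a free R_p-submodule F of rank n (with basis v_0..v_(n-1),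
   i.e. F ~= R_p^n) which is a free E_p-summand of V_p : V_p = F (+) G and the
   coordinates of the projection V_p -> F ~= R_p^n along G are the elements
   phi_i of E_p. *)
Definition free_E_summand_in (p : R -> Prop) (E : (V -> R) -> Prop)
    (N : V -> Prop) (n : nat) : Prop :=
  exists (v : 'I_n -> V * R) (phi : 'I_n -> (V -> R) * R) (G : V * R -> Prop),
  [/\ (forall i, N (v i).1 /\ ~ p (v i).2),
      (forall i, E (phi i).1 /\ ~ p (phi i).2),
      loc_submodule p G,
      (* F + G = V_p, with projection onto F along G equal to
         w |-> sum_i phi_i(w) v_i *)
      (forall w, ~ p w.2 ->
         in_loc p G (fadd w (fopp (fsum (fun i => fscale (feval (phi i) w) (v i))))))
    & (* F /\ G = 0 and v is a basis of F *)
      (forall a : 'I_n -> R * R, (forall i, ~ p (a i).2) ->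
         in_loc p G (fsum (fun i => fscale (a i) (v i))) ->
         forall i, req p (a i) (0, 1))].

(* x is p-free-basic for V with respect to E:
   (Rx)_p = R_p (x/1) is free on x/1, i.e. a/s |-> (a/s)(x/1) is injective,
   and some phi in E_p has phi(x/1) = 1. *)
Definition p_free_basic (p : R -> Prop) (E : (V -> R) -> Prop) (x : V) : Prop :=
  (forall a s, ~ p s -> leq_frac p (a *: x, s) fzero -> req p (a, s) (0, 1))
  /\ exists f s, [/\ E f, ~ p s & req p (f x, s) (1, 1)].

Definition X_free_basic (X : (R -> Prop) -> Prop) (E : (V -> R) -> Prop)
    (x : V) : Prop :=
  forall p, X p -> p_free_basic p E x.

End Module.

Definition sum_dual (R : comPzRingType) (M : lmodType R) (E : (M -> R) -> Prop)
    : ((R^o * M)%type -> R) -> Prop :=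
  fun g => exists c f, E f /\ forall u : (R^o * M)%type, g u = c * u.1 + f u.2.

(* Main.v *)
(** After evaluating [E] on generators of [N] everything is about a finite matrix
    over [R] and its ranks over the residue fields at the primes of [X]; [x] is
    free-basic at [p] iff some [f] in [E] has [f x] outside [p].  Start from the
    rows given by generators of [N] and by [y], and eliminate one row at a time, adding
    multiples of it to the others (to the row of [y], only multiples of [a]) while
    keeping the rank at every [p] in [X] at least [1 + dim_X p], or full
    (Eisenbud-Evans).  Since [X] is basic and [R] is Noetherian, the loci in [X]
    where the rank drops below given bounds lie above finitely many primes; prime
    avoidance prevents any loss of rank at those, and everywhere else the loss
    of one is absorbed by the dimension being strictly smaller than at the
    critical prime below. *)
Require Import Defs.
From HB Require Import structures.
From mathcomp Require Import all_boot all_order all_algebra.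
From mathcomp Require Import ring.
From mathcomp Require Import boolp.
Import GRing.Theory.
Local Open Scope ring_scope.
Set Implicit Arguments. Unset Strict Implicit. Unset Printing Implicit Defensive.

(** * Residue fields of prime ideals *)

Section NzResidue.
Local Open Scope quotient_scope.
Variables (R : comNzRingType) (p : R -> Prop) (hp : is_prime_ideal p).

Definition ideal_pred : {pred R} := fun r => `[< p r >].

Lemma ideal_pred_closed : idealr_closed ideal_pred.
Proof.
case: hp => -[p0 pD pM] p1 _; split; first exact/asboolP.
  exact/asboolPn.
by move=> a u v /asboolP pu /asboolP pv; apply/asboolP/pD => //; apply: pM.
Qed.

Lemma ideal_pred_prime : prime_idealr_closed ideal_pred.
Proof.
case: hp => _ _ pP u v /asboolP/pP [pu|pv]; apply/orP; [left|right];
  exact/asboolP.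
Qed.

HB.instance Definition _ := isIdealr.Build R ideal_pred ideal_pred_closed.
HB.instance Definition _ :=
  isPrimeIdealrClosed.Build R ideal_pred ideal_pred_prime.

Local Notation quo := {ideal_quot (ideal_pred : prime_idealr R)}.

(** [{fraction quo}] asks for an integral domain, a structure that carries units and an inverse;
    both are chosen classically here. *)
Definition quo_unit : pred quo := fun x => `[< exists y : quo, y * x = 1 >].

Definition quo_inv (x : quo) : quo :=
  if pselect (exists y : quo, y * x = 1) is left e then projT1 (cid e) else x.

Lemma quo_mulVr : {in quo_unit, left_inverse 1 quo_inv *%R}.
Proof.
move=> x /asboolP e; rewrite /quo_inv; case: pselect => // e'.
by case: cid.
Qed.

Lemma quo_unitP (x y : quo) : y * x = 1 -> quo_unit x.
Proof. by move=> yx; apply/asboolP; exists y. Qed.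

Lemma quo_inv_out : {in [predC quo_unit], quo_inv =1 id}.
Proof.
by move=> x /asboolP e; rewrite /quo_inv; case: pselect => // e'.
Qed.

HB.instance Definition _ := GRing.ComNzRing_hasMulInverse.Build quo
  quo_mulVr quo_unitP quo_inv_out.

HB.instance Definition _ := GRing.ComUnitRing_isIntegral.Build quo
  (@Quotient.rquot_IdomainAxiom R ideal_pred).

Definition nz_residue_map (r : R) : {fraction quo} := tofrac (\pi_quo r).

Lemma nz_residue_map_zmod : zmod_morphism nz_residue_map.
Proof. by move=> x y; rewrite /nz_residue_map rmorphB -tofracB. Qed.

Lemma nz_residue_map_monoid : monoid_morphism nz_residue_map.
Proof.
by split=> [|x y]; rewrite /nz_residue_map ?rmorph1 // rmorphM -tofracM.
Qed.

Lemma nz_residue_map_eq0 r : nz_residue_map r = 0 <-> p r.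
Proof.
have E : (nz_residue_map r == 0) = (r \in ideal_pred).
  rewrite -[X in X \in _]subr0 Quotient.idealrBE tofrac_eq0.
  by rewrite [RHS]piE [LHS]piE.
by rewrite (rwP eqP) E; split=> /asboolP.
Qed.

HB.instance Definition _ := GRing.isZmodMorphism.Build _ _ nz_residue_map
  nz_residue_map_zmod.
HB.instance Definition _ := GRing.isMonoidMorphism.Build _ _ nz_residue_map
  nz_residue_map_monoid.

Lemma nz_residue_field :
  {K : fieldType & {f : {rmorphism R -> K} | forall r, f r = 0 <-> p r}}.
Proof.
by exists {fraction quo}, nz_residue_map; exact: nz_residue_map_eq0.
Qed.

End NzResidue.

(** A prime ideal omits 1, so [R] can be repacked as a nonzero ring; the resulting map is then
    repacked as a morphism on the original structure. *)
Lemma residue_field (R : comPzRingType) (p : R -> Prop) : is_prime_ideal p ->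
  {K : fieldType & {f : {rmorphism R -> K} | forall r, f r = 0 <-> p r}}.
Proof.
move=> hp.
have nz1 : (1 : R) != 0.
  by apply/eqP => e; case: hp => -[p0 _ _] + _; rewrite e.
pose R' : comNzRingType := HB.pack (GRing.ComPzRing.sort R)
  (GRing.PzSemiRing_isNonZero.Build R nz1).
have [K [f fP]] := @nz_residue_field R' p hp.
have fB : @zmod_morphism R K f := rmorphB f.
have fM : @monoid_morphism R K f := (rmorph1 f, rmorphM f).
pose F : {rmorphism R -> K} := HB.pack (f : R -> K)
  (GRing.isZmodMorphism.Build R K f fB) (GRing.isMonoidMorphism.Build R K f fM).
by exists K, F.
Qed.

(** * Noetherian induction, finite covers of loci in a basic set, and avoidance *)

Section Noetherian.
Variable R : comPzRingType.
Implicit Types (I J D p q : R -> Prop) (X : (R -> Prop) -> Prop).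

Lemma ideal_sum I n (F : 'I_n -> R) :
  is_ideal I -> (forall i, I (F i)) -> I (\sum_(i < n) F i).
Proof. by case=> I0 ID _ IF; elim/big_ind: _ => //. Qed.

Lemma idealB I a b : is_ideal I -> I a -> I b -> I (a - b).
Proof. by case=> _ ID IM Ia Ib; apply: ID => //; rewrite -mulN1r; apply: IM. Qed.

(** A counterexample starts, by choice, a strictly increasing sequence [c] of counterexamples. The
    union is an ideal with finitely many generators, all of them in some [c n0], so the sequence
    cannot grow after [n0]. *)
Lemma noetherian_ind (P : (R -> Prop) -> Prop) :
  noetherian_ring R ->
  (forall I, is_ideal I ->
    (forall J, is_ideal J -> strict_incl I J -> P J) -> P I) ->
  forall I, is_ideal I -> P I.
Proof.
move=> noethR step I0 idI0; apply: contrapT => nPI0.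
pose bad I := is_ideal I /\ ~ P I.
have /choice[g gP] : forall I, exists J, bad I -> bad J /\ strict_incl I J.
  move=> I; have [[idI nPI]|nbad] := pselect (bad I); last by exists I.
  apply: contrapT => noJ; apply: nPI; apply: step => // J idJ IJ.
  by apply: contrapT => nPJ; apply: noJ; exists J.
pose c n := iter n g I0.
have badc n : bad (c n) by elim: n => // n IHn; case: (gP _ IHn).
have cS n r : c n r -> c n.+1 r by case: (gP _ (badc n)) => _ [+ _]; apply.
have cle m n r : (m <= n)%N -> c m r -> c n r.
  by move=> /subnK <-; elim: (n - m)%N => // k IHk /IHk /cS.
pose U r := exists n, c n r.
have idU : is_ideal U.
  split.
  - by exists 0%N; case: idI0.
  - move=> a b [m cma] [n cnb]; exists (maxn m n).
    have [[_ cD _] _] := badc (maxn m n).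
    by apply: cD; [apply: cle cma; apply: leq_maxl|
                   apply: cle cnb; apply: leq_maxr].
  - by move=> r a [n cna]; exists n; have [[_ _ cM] _] := badc n; apply: cM.
have [s sP] := noethR U idU.
have [n0 n0P] : exists n, forall i, (i < size s)%N -> c n s`_i.
  have sU i : (i < size s)%N -> U s`_i.
    move=> ilt; apply/sP; exists (fun j : 'I_(size s) => (j == i :> nat)%:R).
    rewrite (bigD1 (Ordinal ilt)) //= eqxx mul1r big1 ?addr0 // => j.
    by rewrite -val_eqE /= => /negPf ->; rewrite mul0r.
  elim: {sP} s sU => [|x s IHs] sU; first by exists 0%N.
  have [n1 n1P] := IHs (fun i => sU i.+1).
  have [n2 n2P] := sU 0%N isT.
  exists (maxn n1 n2) => -[_|i ilt].
    by apply: cle n2P; apply: leq_maxr.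
  by apply: cle (n1P i ilt); apply: leq_maxl.
have [_ [_ [r [rn1 rn]]]] := gP _ (badc n0).
apply: rn; have [a ->] := (sP r).1 (ex_intro _ n0.+1 rn1).
have [idn _] := badc n0.
by apply: ideal_sum => // i; case: (idn) => _ _; apply; apply: n0P.
Qed.

(** Let [J] be the intersection of the primes of [X] above [I]. If [J] contains 1 there are no such
    primes; if [J] is prime it lies in [X], as [X] is basic, and covers alone. Otherwise some
    [a * b] is in [J] with [a] and [b] outside, and each prime of [X] above [I] contains one of the
    larger ideals [K a] = I + (a) and [K b], to which the induction applies. *)
Lemma finite_cover_ideal X I :
  noetherian_ring R -> subset_Spec X -> basic_set X -> is_ideal I ->
  exists L : seq (R -> Prop),
    (forall q, q \in L -> X q /\ (forall r, I r -> q r)) /\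
    (forall p, X p -> (forall r, I r -> p r) ->
       exists2 q, q \in L & forall r, q r -> p r).
Proof.
move=> noethR specX basicX; move: I; apply: noetherian_ind => // I idI IHI.
pose F p := X p /\ (forall r, I r -> p r).
pose J := bigcap_ideals F.
have IJ r : I r -> J r by move=> Ir q [_]; apply.
have idJ : is_ideal J.
  split=> [q|a b Ja Jb q|r a Ja q] Fq; have [[q0 qD qM] _ _] := specX q Fq.1.
  - by [].
  - by apply: qD; [apply: Ja|apply: Jb].
  - by apply: qM; apply: Ja.
have [J1|nJ1] := pselect (J 1).
  exists [::]; split=> // p Xp Ip; have [_ + _] := specX p Xp.
  by case; apply: J1.
have [prJ|nprJ] := pselect (is_prime_ideal J).
  exists [:: J]; split.
    by move=> q; rewrite inE => /eqP ->; split=> //; apply: basicX prJ => q' [].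
  by move=> p Xp Ip; exists J; rewrite ?inE // => r; apply.
have [a [b [Jab nJa nJb]]] : exists a b, [/\ J (a * b), ~ J a & ~ J b].
  apply: contrapT => nab; apply: nprJ; split=> // a b Jab.
  have [Ja|nJa] := pselect (J a); first by left.
  have [Jb|nJb] := pselect (J b); first by right.
  by case: nab; exists a, b.
pose K a r := exists x y, I x /\ r = x + y * a.
have idK x : is_ideal (K x).
  have [I0 ID IM] := idI; split.
  - by exists 0, 0; rewrite mul0r addr0.
  - move=> _ _ [u [v [Iu ->]]] [u' [v' [Iu' ->]]].
    by exists (u + u'), (v + v'); split; [apply: ID|rewrite mulrDl addrACA].
  - move=> r _ [u [v [Iu ->]]]; exists (r * u), (r * v).
    by split; [apply: IM|rewrite mulrDr mulrA].
have IK x r : I r -> K x r by move=> Ir; exists r, 0; rewrite mul0r addr0.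
have Kx x : K x x by exists 0, 1; case: idI => I0 _ _; rewrite add0r mul1r.
have KI x : ~ J x -> strict_incl I (K x).
  by move=> nJx; split; [exact: IK|exists x; split=> // /IJ].
have [La [LaX LaP]] := IHI _ (idK a) (KI a nJa).
have [Lb [LbX LbP]] := IHI _ (idK b) (KI b nJb).
exists (La ++ Lb); split.
  move=> q; rewrite mem_cat => /orP[/LaX|/LbX] [Xq Kq]; split=> // r Ir;
    exact/Kq/IK.
move=> p Xp Ip; have [[_ pD pM] _ pP] := specX p Xp.
have Kp x : p x -> forall r, K x r -> p r.
  by move=> px r [u [v [Iu ->]]]; apply: pD; [apply: Ip|apply: pM].
case: (pP a b (Jab p (conj Xp Ip))) => [pa|pb].
  have [q qL qp] := LaP p Xp (Kp a pa).
  by exists q; rewrite // mem_cat qL.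
have [q qL qp] := LbP p Xp (Kp b pb).
by exists q; rewrite // mem_cat qL orbT.
Qed.

(** Meant for a set [D] of minors, which need not be an ideal: pass to the ideal that it
    generates. *)
Lemma finite_cover X D :
  noetherian_ring R -> subset_Spec X -> basic_set X ->
  exists L : seq (R -> Prop),
    (forall q, q \in L -> X q /\ (forall r, D r -> q r)) /\
    (forall p, X p -> (forall r, D r -> p r) ->
       exists2 q, q \in L & forall r, q r -> p r).
Proof.
move=> noethR specX basicX.
pose I := bigcap_ideals (fun J => is_ideal J /\ forall r, D r -> J r).
have idI : is_ideal I.
  split=> [J|a b Ia Ib J|r a Ia J] [idJ DJ]; have [J0 JD JM] := idJ.
  - by [].
  - by apply: JD; [apply: Ia|apply: Ib].
  - by apply: JM; apply: Ia.
have [L [LX LP]] := finite_cover_ideal noethR specX basicX idI.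
exists L; split.
  by move=> q /LX[Xq Iq]; split=> // r Dr; apply: Iq => J [_]; apply.
move=> p Xp Dp; apply: LP => // r; apply; split=> //.
by case: (specX p Xp).
Qed.

(** Multiply one element of each [q] chosen outside [p]; the product stays outside because [p] is
    prime. *)
Lemma bigcap_avoid (L : seq (R -> Prop)) p :
  is_prime_ideal p -> (forall q, q \in L -> is_prime_ideal q) ->
  (forall q, q \in L -> ~ (forall r, q r -> p r)) ->
  exists r, ~ p r /\ forall q, q \in L -> q r.
Proof.
move=> [idp p1 pP]; elim: L => [|q L IHL] primeL nsub; first by exists 1.
have inL q' : q' \in L -> q' \in q :: L by rewrite inE => ->; rewrite orbT.
have [r [npr rL]] := IHL (fun q' h => primeL q' (inL q' h))
                         (fun q' h => nsub q' (inL q' h)).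
have /existsNP[u /not_implyP[qu npu]] := nsub q (mem_head _ _).
exists (u * r); split; first by case/pP.
move=> q'; rewrite inE => /predU1P[->|q'L].
  by have [[_ _ qM] _ _] := primeL q (mem_head _ _); rewrite mulrC; apply: qM.
have [[_ _ qM] _ _] := primeL q' (inL q' q'L).
by apply: qM; apply: rL.
Qed.

Lemma exists_minimal_incl (L : seq (R -> Prop)) : L != [::] ->
  exists2 m, m \in L &
    forall q, q \in L -> (forall r, q r -> m r) -> (forall r, m r -> q r).
Proof.
elim: L => // p L IHL _; have [L0|Lnz] := eqVneq L [::].
  by exists p; rewrite L0 ?inE // => q; rewrite inE => /eqP ->.
have [m mL mP] := IHL Lnz.
have [pm|npm] := pselect (forall r, p r -> m r).
  exists p; first exact: mem_head.
  move=> q; rewrite inE => /predU1P[-> //|qL] qp r pr.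
  by apply: (mP q qL) => [s /qp /pm|]//; apply: pm.
exists m; first by rewrite inE mL orbT.
by move=> q; rewrite inE => /predU1P[->|/mP].
Qed.

End Noetherian.

(** * Matrix rank over a field: minors and rank-one corrections *)

Section FieldRank.
Variable K : fieldType.

Lemma mxrank_rowsub m n k (f : 'I_k -> 'I_m) (A : 'M[K]_(m, n)) :
  (\rank (rowsub f A) <= \rank A)%N.
Proof. by apply/mxrankS/row_subP => i; rewrite row_rowsub row_sub. Qed.

Lemma mxrank_mxsub m n k l (f : 'I_k -> 'I_m) (g : 'I_l -> 'I_n)
  (A : 'M[K]_(m, n)) : (\rank (mxsub f g A) <= \rank A)%N.
Proof.
rewrite mxsubrc; apply: leq_trans (mxrank_rowsub _ _) _.
by rewrite -mxrank_tr trmx_mxsub -[leqRHS]mxrank_tr mxrank_rowsub.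
Qed.

Lemma mxrank_minor m n (A : 'M[K]_(m, n)) :
  exists (f : 'I_(\rank A) -> 'I_m) (g : 'I_(\rank A) -> 'I_n),
    \det (mxsub f g A) != 0.
Proof.
pose B := rowsub (maxrankfun A) A.
have fullB : row_full B^T.
  by rewrite /row_full mxrank_tr; apply: maxrowsub_free.
exists (maxrankfun A), (fullrankfun fullB).
rewrite -unitfE -unitmxE -unitmx_tr trmx_mxsub mxsubrc.
rewrite -[colsub _ _]trmx_mxsub.
exact: fullrowsub_unit.
Qed.

Lemma mxrank_det m n k (f : 'I_k -> 'I_m) (g : 'I_k -> 'I_n)
  (A : 'M[K]_(m, n)) : \det (mxsub f g A) != 0 -> (k <= \rank A)%N.
Proof.
rewrite -unitfE -unitmxE => u; apply: leq_trans (mxrank_mxsub f g A).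
by rewrite mxrank_unit.
Qed.

(** The rows of [T] are recovered from [s] and [T + c *m s], so discarding [s] costs at most one. *)
Lemma mxrank_col_mx_step n k (T : 'M[K]_(n, k)) (s : 'rV_k) (c : 'cV_n) :
  (\rank (col_mx s T) <= (\rank (T + c *m s)%R).+1)%N.
Proof.
have sub : (col_mx s T <= s + (T + c *m s)%R)%MS.
  rewrite col_mx_sub addsmxSl -[X in (X <= _)%MS](addrK (c *m s)).
  by rewrite addmx_sub ?addsmxSr // -mulNmx mulmx_sub ?addsmxSl.
apply: leq_trans (mxrankS sub) _; rewrite -[leqRHS]addn1.
apply: leq_trans (mxrank_adds_leqif _ _) _.
by rewrite addnC leq_add2l rank_leq_row.
Qed.

Lemma mxrank_col_mx_shear n k (T : 'M[K]_(n, k)) (s : 'rV_k) (c : 'cV_n) :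
  \rank (col_mx s (T + c *m s)) = \rank (col_mx s T).
Proof.
have sub (A : 'M_(n, k)) (d : 'cV_n) : (col_mx s (A + d *m s)%R <= s + A)%MS.
  by rewrite col_mx_sub addsmxSl addmx_sub ?addsmxSr // mulmx_sub ?addsmxSl.
apply: eqmx_rank; apply/andP; split.
  by have := sub T c; rewrite addsmxE.
have := sub (T + c *m s) (- c); rewrite mulNmx addrK.
by rewrite addsmxE.
Qed.

(* A relation [u *m T = 0] exhibits [s] as a multiple of [u *m (T + c *m s)]. *)
Lemma mxrank_add_rank1 n k (T : 'M[K]_(n, k)) (s : 'rV_k) (c : 'cV_n)
    (u : 'rV_n) : u *m T = 0 -> (u *m c) 0 0 != 0 ->
  (\rank (col_mx s T) <= \rank (T + c *m s)%R)%N.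
Proof.
move=> uT ucn0; apply: mxrankS; rewrite col_mx_sub.
have sT : (s <= (T + c *m s)%R)%MS.
  apply/submxP; exists (((u *m c) 0 0)^-1 *: u).
  rewrite -scalemxAl mulmxDr uT add0r mulmxA [u *m c]mx11_scalar.
  by rewrite mul_scalar_mx scalerA mxE eqxx mulr1n mulVf ?scale1r.
rewrite sT -[X in (X <= _)%MS](addrK (c *m s)) addmx_sub //.
by rewrite -mulNmx mulmx_sub.
Qed.

End FieldRank.

(** * Ranks at primes, and corrections at finitely many of them *)

Section Rank.
Variable R : comPzRingType.
Implicit Types (p q : R -> Prop).

(** The value 0 away from prime ideals is a dummy that makes the rank total in [p]. *)
Definition rank_at p m n (A : 'M[R]_(m, n)) : nat :=
  if pselect (is_prime_ideal p) is left hp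
  then \rank (map_mx (sval (projT2 (residue_field hp))) A) else 0%N.

Lemma rank_atE p : is_prime_ideal p ->
  exists (K : fieldType) (f : {rmorphism R -> K}),
    (forall r, f r = 0 <-> p r) /\
    (forall m n (A : 'M[R]_(m, n)), rank_at p A = \rank (map_mx f A)).
Proof.
move=> hp; rewrite /rank_at; case: pselect => // hp'.
exists (projT1 (residue_field hp')), (sval (projT2 (residue_field hp'))).
by split=> //; case: (residue_field hp') => K [].
Qed.

(** Arbitrary index maps are harmless: a repetition gives a zero determinant and a reordering only a
    sign. *)
Definition large_minor t m n (A : 'M[R]_(m, n)) (r : R) : Prop :=
  exists k (f : 'I_k -> 'I_m) (g : 'I_k -> 'I_n),
    (t < k)%N /\ r = \det (mxsub f g A).

Lemma rank_at_minors p t m n (A : 'M[R]_(m, n)) : is_prime_ideal p ->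
  (rank_at p A <= t)%N <-> (forall r, large_minor t A r -> p r).
Proof.
move=> /rank_atE[K [f [fP ->]]]; split.
  move=> rA r [k [g [h [tk ->]]]]; apply/fP; rewrite -det_map_mx map_mxsub.
  apply/eqP; apply: contraLR tk => /mxrank_det kr.
  by rewrite -leqNgt (leq_trans kr).
move=> minp; rewrite leqNgt; apply/negP => trA.
have [g [h]] := mxrank_minor (map_mx f A).
rewrite -map_mxsub det_map_mx => /eqP; apply; apply/fP/minp.
by exists (\rank (map_mx f A)), g, h.
Qed.

Lemma rank_at_le_row p m n (A : 'M[R]_(m, n)) : (rank_at p A <= m)%N.
Proof. by rewrite /rank_at; case: pselect => // ?; apply: rank_leq_row. Qed.

Lemma rank_at_col_mx_step p n k (T : 'M[R]_(n, k)) (s : 'rV_k) (c : 'cV_n) :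
  (rank_at p (col_mx s T) <= (rank_at p (T + c *m s)).+1)%N.
Proof.
rewrite /rank_at; case: pselect => // hp; rewrite map_col_mx map_mxD map_mxM.
exact: mxrank_col_mx_step.
Qed.

Lemma rank_at_eqmod p m n (A B : 'M[R]_(m, n)) : is_prime_ideal p ->
  (forall i j, p (A i j - B i j)) -> rank_at p A = rank_at p B.
Proof.
move=> /rank_atE[K [f [fP rkE]]] AB; rewrite !rkE; congr (\rank _).
apply/matrixP => i j; rewrite !mxE; apply/eqP; rewrite -subr_eq0 -rmorphB.
exact/eqP/fP.
Qed.

(** Since [T] lacks full row rank at [p], its rows satisfy a nontrivial relation [u] over the
    residue field. Correcting a row [i] with [u 0 i != 0] makes [s] recoverable. Row [i0] may
    receive only multiples of [a], so another [i] is preferred; if [u] is supported at [i0] alone,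
    row [i0] of [T] vanishes at [p], and then [a] is outside [p] by hypothesis. *)
Lemma rank_at_add_rank1 p n k (T : 'M[R]_(n.+1, k)) (s : 'rV_k)
    (i0 : 'I_n.+1) (a r : R) :
  is_prime_ideal p -> ~ p r -> (~ p a \/ exists j, ~ p (T i0 j)) ->
  (rank_at p T <= n)%N ->
  exists i : 'I_n.+1, (rank_at p (col_mx s T) <=
    rank_at p (T + (r * (if i == i0 then a else 1)) *: delta_mx i 0 *m s)%R)%N.
Proof.
move=> hp npr pa; have [_ p1 pP] := hp.
have [K [f [fP rkE]]] := rank_atE hp.
rewrite !rkE => rT; set T' := map_mx f T in rT.
have [u [uT un0]] : exists u : 'rV_n.+1, u *m T' = 0 /\ u != 0.
  have : ~~ row_free T' by rewrite /row_free neq_ltn ltnS rT.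
  rewrite -kermx_eq0 => /rowV0Pn[u /sub_kermxP uT un0].
  by exists u.
have [i [ui api]] : exists i, u 0 i != 0 /\ (i = i0 -> ~ p a).
  have [/existsP[i /andP[ii0 ui]]|] :=
    boolP [exists i, (i != i0) && (u 0 i != 0)].
    by exists i; split=> // e; rewrite e eqxx in ii0.
  rewrite negb_exists => /forallP u0.
  have uj j : j != i0 -> u 0 j = 0.
    by move=> j0; have := u0 j; rewrite j0 negbK => /eqP.
  have u00 : u 0 i0 != 0.
    apply: contraNneq un0 => u00; apply/eqP/rowP => j; rewrite mxE.
    by have [->|/uj] := eqVneq j i0.
  exists i0; split=> // _; case: pa => // -[j nTj] _; apply: nTj; apply/fP.
  have := congr1 (fun v : 'rV_k => v 0 j) uT; rewrite !mxE.
  rewrite (bigD1 i0) //= big1 ?addr0; last by move=> l /uj ->; rewrite mul0r.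
  by rewrite mxE => /eqP; rewrite mulf_eq0 (negPf u00) => /eqP.
exists i; rewrite !rkE map_col_mx map_mxD map_mxM.
apply: (mxrank_add_rank1 _ uT); rewrite map_mxZ map_delta_mx -scalemxAr.
rewrite -colE !mxE mulf_neq0 //; apply/eqP => /fP.
case/pP => //; case: eqP => // ii0; exact: api.
Qed.

(** Induction on the size of [L], setting aside a minimal member [m]. Once the other primes are
    treated, the correction at [m] is scaled by some [r] that lies in all of them but not in [m], so
    it is invisible at the others. The bound [n.+1] excludes the rank [n.+2], which [n.+1] rows
    cannot keep. *)
Lemma avoid_critical n k (T : 'M[R]_(n.+1, k)) (s : 'rV_k)
    (i0 : 'I_n.+1) a
    (L : seq (R -> Prop)) :
  (forall q, q \in L -> is_prime_ideal q) ->
  (forall q, q \in L -> ~ q a \/ exists j, ~ q (T i0 j)) ->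
  exists c : 'cV_n.+1, (exists b, c i0 0 = a * b) /\
    forall q, q \in L -> (rank_at q (col_mx s T) <= n.+1)%N ->
      (rank_at q (col_mx s T) <= rank_at q (T + c *m s))%N.
Proof.
have [l] := ubnP (size L); elim: l L => // l IHl L; rewrite ltnS => szL pL aL.
have [L0|Lnz] := eqVneq L [::].
  by exists 0; split=> [|q]; [exists 0; rewrite mxE mulr0|rewrite L0].
have [m mL mmin] := exists_minimal_incl Lnz.
pose L' := [seq q <- L | `[< ~ forall r, q r -> m r >]].
have L'P q : q \in L -> q = m \/ q \in L'.
  move=> qL; have [qm|nqm] := pselect (forall r, q r -> m r).
    by left; apply/predeqP => r; split; [apply: qm|apply: mmin].
  by right; rewrite mem_filter qL andbT; apply/asboolP.
have L'L q : q \in L' -> q \in L by rewrite mem_filter => /andP[].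
have szL' : (size L' < l)%N.
  apply: leq_trans szL; rewrite size_filter ltn_neqAle count_size andbT.
  rewrite -all_count; apply/negP => /allP/(_ m mL)/asboolP; exact.
have [c [[b c0] cP]] := IHl L' szL' (fun q h => pL q (L'L q h))
  (fun q h => aL q (L'L q h)).
set T1 := T + c *m s in cP.
have [r [nmr rL']] : exists r, ~ m r /\ forall q, q \in L' -> q r.
  apply: bigcap_avoid (pL m mL) _ _ => q; first by move/L'L/pL.
  by rewrite mem_filter => /andP[/asboolP].
have rk1 q d : rank_at q (col_mx s (T + d *m s)) = rank_at q (col_mx s T).
  rewrite /rank_at; case: pselect => // hq; rewrite !map_col_mx map_mxD map_mxM.
  exact: mxrank_col_mx_shear.
(* If [T1] already has full rank [n.+1] at [m], the correction [c] suffices. *)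
have [rT1|rT1] := leqP (rank_at m T1) n; last first.
  exists c; split; first by exists b.
  move=> q /L'P[->|/cP //] rA; exact: leq_trans rT1.
(* Row [i0] has changed by a multiple of [a] only, hence not modulo [m] when [a] is in [m]. *)
have T1a : ~ m a \/ exists j, ~ m (T1 i0 j).
  have [ma|] := pselect (m a); last by left.
  case: (aL m mL) => // -[j nmT]; right; exists j.
  have [[m0 mD mM] _ _] := pL m mL.
  rewrite !mxE big_ord1 c0 => mT1; apply: nmT.
  rewrite -(addrK (a * b * s 0 j) (T i0 j)); apply: idealB mT1 _.
    by have [] := pL m mL.
  by rewrite -mulrA mulrC; apply: mM.
have [i iP] := rank_at_add_rank1 s (pL m mL) nmr T1a rT1.
set d := _ *: delta_mx i 0 in iP.
exists (c + d); split.
  rewrite !mxE c0; have [_|_] := eqVneq i i0.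
    by exists (b + r); rewrite mulr1 mulrDr [a * r]mulrC.
  by exists b; rewrite mulr0 addr0.
have TE : T + (c + d) *m s = T1 + d *m s by rewrite mulmxDl addrA.
rewrite TE => q /L'P[->|qL'] rA; first by rewrite -(rk1 m c).
have [idq _ _] := pL q (L'L q qL').
rewrite (@rank_at_eqmod q _ _ (T1 + _) T1) ?cP // => [|i' j].
  exact/pL/L'L.
have [_ _ qM] := idq.
rewrite [X in X - _]mxE addrAC subrr add0r mxE big_ord1 !mxE.
by rewrite mulrAC mulrAC -!mulrA mulrC; apply: qM; apply: rL'.
Qed.

End Rank.

(** * Elimination of rows over a basic set *)

Section Descent.
Variables (R : comPzRingType) (X : (R -> Prop) -> Prop).
Hypotheses (noethR : noetherian_ring R) (specX : subset_Spec X)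
  (basicX : basic_set X).

Lemma one_plus_dimX_le_mono p r r' :
  (r <= r')%N -> one_plus_dimX_le X p r -> one_plus_dimX_le X p r'.
Proof. by move=> rr' h n c /h nr; apply: leq_trans rr'. Qed.

Lemma one_plus_dimX_gt0 p r : X p -> one_plus_dimX_le X p r -> (0 < r)%N.
Proof. by move=> Xp /(_ 0%N (fun=> p)); apply. Qed.

(** Prepending [q] lengthens every chain that starts at [p] by one. *)
Lemma one_plus_dimX_strict q p r : X q -> strict_incl q p ->
  one_plus_dimX_le X q r -> one_plus_dimX_le X p r.-1.
Proof.
move=> Xq qp hq n c [c0 cX cS].
have : (n.+1 + 1 <= r)%N.
  apply: (hq _ (fun i => if i is j.+1 then c j else q)); split=> //.
    by case.
  by case=> [|i]; rewrite ?c0 // ltnS => /cS.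
by case: r {hq}.
Qed.

(** Full row rank is allowed because the elimination may leave fewer rows than [1 + dim_X p]. *)
Definition rank_ok p m n (A : 'M[R]_(m, n)) : Prop :=
  rank_at p A = m \/ one_plus_dimX_le X p (rank_at p A).

(* At a prime of [X] outside the critical list, a critical prime strictly below
   it makes the dimension drop absorb the loss of one in the rank. *)
Lemma drop_row n k (s : 'rV[R]_k) (T : 'M[R]_(n.+1, k)) i0 a :
  (forall p, X p -> ~ p a \/ exists j, ~ p (T i0 j)) ->
  (forall p, X p -> rank_ok p (col_mx s T)) ->
  exists c : 'cV_n.+1, (exists b, c i0 0 = a * b) /\
    forall p, X p -> rank_ok p (T + c *m s).
Proof.
move=> aT okA; set A := col_mx s T in okA *.
have /choice[L LP] := fun t : nat =>
  finite_cover (large_minor t A) noethR specX basicX.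
(* Bounds [t] up to [n.+1] suffice: [A] has [n.+2] rows, and where it has full rank, losing one
   still leaves the remaining [n.+1] rows with full rank. *)
pose Lc := flatten [seq L t | t <- iota 0 n.+2].
have LcX q : q \in Lc -> X q.
  by case/flattenP => _ /mapP[t _ ->] /(LP t).1[].
have [c [c0 cP]] := avoid_critical s (fun q h => specX (LcX q h))
  (fun q h => aT q (LcX q h)).
exists c; split=> // p Xp.
have rkT := rank_at_col_mx_step p T s c; rewrite -/A in rkT.
have [rA|rA] := ltnP n.+1 (rank_at p A).
  left; apply/eqP; rewrite eqn_leq rank_at_le_row.
  by rewrite -ltnS (leq_trans rA).
have dimp : one_plus_dimX_le X p (rank_at p A).
  by case: (okA p Xp) => // rAE; rewrite rAE ltnn in rA.
right.
have [pL|npL] := pselect (p \in Lc).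
  exact: one_plus_dimX_le_mono (cP p pL rA) dimp.
have minp := (rank_at_minors (rank_at p A) A (specX Xp)).1 (leqnn _).
have [q qL qp] := (LP (rank_at p A)).2 p Xp minp.
have [Xq minq] := (LP (rank_at p A)).1 q qL.
have rqp := (rank_at_minors (rank_at p A) A (specX Xq)).2 minq.
(* At [q] the rank of [A] is at most that at [p], hence not full, so [rank_ok] gives the dimension
   bound. *)
have dimq : one_plus_dimX_le X q (rank_at p A).
  apply: one_plus_dimX_le_mono (rqp) _; case: (okA q Xq) => // rAE.
  by move: rqp; rewrite rAE leqNgt ltnS rA.
have qLc : q \in Lc.
  by apply/flattenP; exists (L (rank_at p A)); rewrite // map_f // mem_iota.
apply: (one_plus_dimX_le_mono (r := (rank_at p A).-1)).
  by rewrite -subn1 leq_subLR; exact: rkT.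
(* The inclusion of [q] in [p] is strict, because [q] is in [Lc] and [p] is not. *)
apply: one_plus_dimX_strict Xq _ dimq; split=> //.
apply: contrapT => nex; apply: npL.
suff -> : p = q by [].
apply/predeqP => r; split=> [pr|/qp //].
by apply: contrapT => nqr; apply: nex; exists r.
Qed.

(** Top rows are dropped until the last one is alone; being of rank at least one at every [p] in
    [X], it is nonzero there. The vector [b] accumulates the multiples of [a] added to it on the
    way. *)
Lemma exists_basic_combination n k (A : 'M[R]_(n.+1, k)) a :
  (forall p, X p -> ~ p a \/ exists j, ~ p (A ord_max j)) ->
  (forall p, X p -> rank_ok p A) ->
  exists b : 'rV_n.+1, forall p, X p ->
    exists j, ~ p (A ord_max j + a * (b *m A) 0 j).
Proof.
elim: n A => [|n IHn] A aA okA.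
  exists 0 => p Xp.
  have [K [f [fP rkE]]] := rank_atE (specX Xp).
  have rA : (0 < rank_at p A)%N.
    by case: (okA p Xp) => [-> //|/(one_plus_dimX_gt0 Xp)].
  apply: contrapT => /forallNP pA; move: rA; rewrite rkE.
  rewrite (_ : map_mx f A = 0) ?mxrank0 //; apply/matrixP => i j.
  rewrite !mxE ord1; apply/fP; have := contrapT (pA j).
  by rewrite mul0mx mxE mulr0 addr0 (ord1 ord_max).
pose s := usubmx (A : 'M_(1 + n.+1, k)); pose T := dsubmx (A : 'M_(1 + n.+1, k)).
have AE : A = col_mx s T by rewrite [col_mx _ _]vsubmxK.
have AT j : A ord_max j = T ord_max j.
  by rewrite mxE; congr (A _ _); apply: val_inj.
clearbody s T.
have aT p : X p -> ~ p a \/ exists j, ~ p (T ord_max j).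
  by move=> /aA[|[j]]; [left|rewrite AT; right; exists j].
have [|c [[b0 c0] cP]] := drop_row (s := s) aT; first by rewrite -AE.
have [|b bP] := IHn (T + c *m s) _ cP.
  move=> p Xp; case: (aT p Xp) => [|[j npT]]; first by left.
  have [pa|] := pselect (p a); last by left.
  right; exists j; rewrite !mxE big_ord1 c0 => pT; apply: npT.
  have [idp _ _] := specX Xp.
  rewrite -(addrK (a * b0 * s 0 j) (T ord_max j)); apply: idealB pT _ => //.
  by have [_ _ pM] := idp; rewrite -mulrA mulrC; apply: pM.
(* As the last entry of [c] is [a * b0], the row [s] enters with [a * b0] directly and with
   [a * (b *m c)] through the corrected rows. *)
exists (row_mx (b0%:M + b *m c) b) => p /bP[j npj]; exists j.
suff -> : A ord_max j + a * ((row_mx (b0%:M + b *m c) b : 'rV_n.+2) *m A) 0 j =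
  (T + c *m s) ord_max j + a * (b *m (T + c *m s)) 0 j by [].
have E : (row_mx (b0%:M + b *m c) b : 'rV_n.+2) *m A =
  (b0%:M + b *m c) *m s + b *m T by rewrite AE;
  exact: (@mul_row_col _ 1 1 n.+1 k).
rewrite AT E mulmxDl mulmxDr mul_scalar_mx mulmxA.
have addE (u v : 'rV[R]_k) : (u + v) 0 j = u 0 j + v 0 j by rewrite mxE.
have scaleE : (b0 *: s) 0 j = b0 * s 0 j by rewrite mxE.
have -> : (T + c *m s) ord_max j = T ord_max j + a * b0 * s 0 j.
  by rewrite mxE [X in _ + X]mxE big_ord1 c0.
rewrite !addE scaleE -!addrA !mulrDr !mulrA; congr (_ + (_ + _)).
by rewrite addrC.
Qed.

End Descent.

(** * Passage from modules and localizations to matrices *)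

Lemma noetherian_row_fin_gen (R : comPzRingType) m (W : 'rV[R]_m -> Prop) :
  noetherian_ring R -> W 0 -> (forall u v, W u -> W v -> W (u + v)) ->
  (forall r u, W u -> W (r *: u)) ->
  exists k (C : 'M[R]_(k, m)), (forall i, W (row i C)) /\
    (forall w, W w -> exists u : 'rV_k, w = u *m C).
Proof.
move=> noethR; elim: m W => [|m IHm] W W0 WD WZ.
  exists 0%N, 0; split=> [[]//|w _]; exists 0.
  by apply/rowP => -[].
(* The leading coordinates of [W] form an ideal. Lifts of its generators clear the leading
   coordinate of any row, leaving a row that is covered by the induction hypothesis. *)
pose I r := exists2 w, W w & w 0 0 = r.
have idI : is_ideal I.
  split.
  - by exists 0; rewrite ?mxE.
  - by move=> _ _ [u Wu <-] [v Wv <-]; exists (u + v); [apply: WD|rewrite mxE].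
  - by move=> r _ [u Wu <-]; exists (r *: u); [apply: WZ|rewrite mxE].
have [s sP] := noethR I idI.
have /choice[w wP] : forall i : 'I_(size s), exists w, W w /\ w 0 0 = s`_i.
  move=> i; suff [w] : I s`_i by exists w.
  apply/sP; exists (fun j => (j == i)%:R).
  rewrite (bigD1 i) //= eqxx mul1r big1 ?addr0 // => j /negPf->.
  by rewrite mul0r.
pose W' (v : 'rV_m) := W (row_mx (0 : 'rV_1) v : 'rV_(1 + m)).
have [k [C [CW CP]]] : exists k (C : 'M[R]_(k, m)), (forall i, W' (row i C)) /\
    (forall w, W' w -> exists u : 'rV_k, w = u *m C).
  apply: IHm; rewrite /W'.
  - by rewrite row_mx0.
  - by move=> u v Wu Wv; have := WD _ _ Wu Wv; rewrite
      (@add_row_mx _ 1 1 m) addr0.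
  - by move=> r u /(WZ r); rewrite
      (@scale_row_mx _ 1 1 m) scaler0.
exists (size s + k)%N,
  (col_mx (\matrix_i w i) (row_mx (0 : 'cV_k) C : 'M_(k, 1 + m))).
split=> [i|v Wv].
  rewrite -[i]splitK; case: (split i) => j /=.
    by rewrite rowKu rowK; case: (wP j).
  by rewrite rowKd (@row_row_mx _ k 1 m) row0; apply: CW.
have [c cE] := (sP (v 0 0)).1 (ex_intro2 _ _ v Wv erefl).
pose v' := v - \row_i c i *m \matrix_i w i.
have WB : W (\row_i c i *m \matrix_i w i).
  rewrite mulmx_sum_row; elim/big_ind: _ => // i _.
  by rewrite rowK; apply: WZ; case: (wP i).
have Wv' : W v' by apply: WD => //; rewrite -scaleN1r; apply: WZ.
have lv' : lsubmx (v' : 'rV_(1 + m)) = 0.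
  apply/rowP => i.
  rewrite ord1 !mxE (_ : lshift m 0 = 0); last exact: val_inj.
  rewrite cE; apply/eqP; rewrite subr_eq0; apply/eqP/eq_bigr => j _.
  by rewrite !mxE; case: (wP j) => _ ->.
have v'E : v' = row_mx (0 : 'rV_1) (rsubmx (v' : 'rV_(1 + m))).
  by rewrite -[LHS](@hsubmxK _ 1 1 m) lv'.
have [|u uE] := CP (rsubmx (v' : 'rV_(1 + m))); first by rewrite /W' -v'E.
exists (row_mx (\row_i c i) u).
rewrite mul_row_col (@mul_mx_row _ 1 k 1 m) mulmx0 -uE -v'E.
by rewrite addrC subrK.
Qed.

Section Dual.
Variables (R : comPzRingType) (V : lmodType R) (E : (V -> R) -> Prop).
Hypothesis dualE : is_dual_submodule E.
Variables (f : V -> R) (Ef : E f).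

Lemma dual0 : f 0 = 0.
Proof.
have [lin _ _ _] := dualE; have := lin f Ef 1 0 0.
by rewrite scaler0 addr0 mul1r -[LHS]addr0 => /addrI.
Qed.

Lemma dualZ r v : f (r *: v) = r * f v.
Proof.
by have [lin _ _ _] := dualE; have := lin f Ef r v 0; rewrite dual0 !addr0.
Qed.

Lemma dualD u v : f (u + v) = f u + f v.
Proof.
by have [lin _ _ _] := dualE; have := lin f Ef 1 u v; rewrite scale1r mul1r.
Qed.

Lemma dual_sum n (b : 'I_n -> R) (h : 'I_n -> V) :
  f (\sum_(i < n) b i *: h i) = \sum_(i < n) b i * f (h i).
Proof.
by rewrite (big_morph f dualD dual0); under eq_bigr => i _ do rewrite dualZ.
Qed.

End Dual.

Section Localization.
Variables (R : comPzRingType) (V : lmodType R) (p : R -> Prop).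
Hypothesis primep : is_prime_ideal p.
Implicit Types (x y z : V * R) (E : (V -> R) -> Prop).

Lemma prime_notM a b : ~ p a -> ~ p b -> ~ p (a * b).
Proof. by have [_ _ pP] := primep; move=> na nb /pP[]. Qed.

Lemma prime_not1 : ~ p 1. Proof. by case: primep. Qed.

Lemma prime_mulr a b : p b -> p (a * b).
Proof. by have [[_ _ pM] _ _] := primep; apply: pM. Qed.

Lemma leq_fracE x y :
  leq_frac p x y <-> exists u, ~ p u /\ (u * y.2) *: x.1 = (u * x.2) *: y.1.
Proof.
by split=> -[u [npu e]]; exists u; split=> //; apply/eqP;
  move/eqP: e; rewrite scalerBr !scalerA subr_eq0.
Qed.

Lemma leq_frac_sym x y : leq_frac p x y -> leq_frac p y x.
Proof. by move=> /leq_fracE[u [npu e]]; apply/leq_fracE; exists u. Qed.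

Lemma leq_frac_trans x y z : ~ p y.2 ->
  leq_frac p x y -> leq_frac p y z -> leq_frac p x z.
Proof.
move=> npy /leq_fracE[u [npu xy]] /leq_fracE[u' [npu' yz]].
apply/leq_fracE; exists (u * u' * y.2).
split; first by do !apply: prime_notM.
have -> : u * u' * y.2 * z.2 = u' * z.2 * (u * y.2) by ring.
rewrite -scalerA xy scalerA.
have -> : u' * z.2 * (u * x.2) = u * x.2 * (u' * z.2) by ring.
by rewrite -scalerA yz scalerA; congr (_ *: _); ring.
Qed.

(** Over a common denominator [D], [fadd] becomes addition in [V]. *)
Lemma leq_frac_add x y v w D :
  leq_frac p x (v, D) -> leq_frac p y (w, D) ->
  leq_frac p (fadd x y) (v + w, D).
Proof.
move=> /leq_fracE[u [npu /= xv]] /leq_fracE[u' [npu' /= yw]].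
apply/leq_fracE; exists (u * u'); split=> /=; first exact: prime_notM.
rewrite !scalerDr !scalerA; congr (_ + _).
  have -> : u * u' * D * y.2 = u' * y.2 * (u * D) by ring.
  by rewrite -scalerA xv scalerA; congr (_ *: _); ring.
have -> : u * u' * D * x.2 = u * x.2 * (u' * D) by ring.
by rewrite -scalerA yw scalerA; congr (_ *: _); ring.
Qed.

Lemma leq_frac_opp x v D :
  leq_frac p x (v, D) -> leq_frac p (fopp x) (- v, D).
Proof.
move=> /leq_fracE[u [npu /= xv]]; apply/leq_fracE; exists u; split=> //=.
by rewrite !scalerN xv.
Qed.

Lemma leq_frac_sum n (F : 'I_n -> V * R) (v : 'I_n -> V) D :
  (forall i, ~ p (F i).2) -> (forall i, leq_frac p (F i) (v i, D)) ->
  ~ p (fsum F).2 /\ leq_frac p (fsum F) (\sum_(i < n) v i, D).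
Proof.
move=> npF Fv; rewrite /fsum.
elim/big_ind2: _ => [|x1 x2 y1 y2 [np1 e1] [np2 e2]|i _] //=.
- split; first exact: prime_not1.
  by apply/leq_fracE; exists 1; rewrite !scaler0; split=> //; apply: prime_not1.
- by split; [apply: prime_notM|apply: leq_frac_add].
Qed.

(** The difference of [v j] and its projection lies in [G], and it is a combination of the basis
    [v]. Its coordinates, the Kronecker delta minus [phi l] at [v j], therefore vanish in the local
    ring. Clearing denominators multiplies by elements outside [p], so diagonal values are only
    known to be outside [p]. *)
Lemma free_summand_diag E (N : V -> Prop) n : free_E_summand_in p E N n ->
  exists (v : 'I_n -> V) (f : 'I_n -> V -> R),
  [/\ forall i, N (v i), forall i, E (f i)
    & forall i j, p (f i (v j)) <-> i != j].
Proof.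
move=> [v [phi [G [vP phiP _ Gproj Gind]]]].
exists (fun i => (v i).1), (fun i => (phi i).1).
split=> [i|i|i j]; [by case: (vP i)|by case: (phiP i)|].
have npv l : ~ p (v l).2 by case: (vP l).
have npphi l : ~ p (phi l).2 by case: (phiP l).
(* The fraction [b l / d l] is the [l]-th coordinate of that difference, [D] is a common denominator
   and [K l] the cofactor of [den l]. *)
pose d l := (phi l).2 * (v j).2.
have npd l : ~ p (d l) by apply: prime_notM.
pose b l := (l == j)%:R * d l - (phi l).1 (v j).1.
pose den l := d l * (v l).2.
have npden l : ~ p (den l) by apply: prime_notM.
pose D := \prod_l den l; pose K i := \prod_(l | l != i) den l.
have DE l : D = K l * den l by rewrite /D (bigD1 l) //= mulrC.
have npD : ~ p D.
  rewrite /D; elim/big_ind: _ => //; first exact: prime_not1.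
  exact: prime_notM.
have leqK (r : R) l :
    leq_frac p (r *: (v l).1, den l) ((K l * r) *: (v l).1, D).
  apply/leq_fracE; exists 1; split; first exact: prime_not1.
  by rewrite /= !scalerA (DE l); congr (_ *: _); ring.
have [npS1 S1] := leq_frac_sum
  (F := fun l => fscale (feval (phi l) (v j)) (v l)) npden
  (fun l => leqK ((phi l).1 (v j).1) l).
have [_ S2] := leq_frac_sum (F := fun l => fscale (b l, d l) (v l)) npden
  (fun l => leqK (b l) l).
have vj : leq_frac p (v j) ((K j * d j) *: (v j).1, D).
  apply/leq_fracE; exists 1; split; first exact: prime_not1.
  by rewrite /= !scalerA (DE j) /den; congr (_ *: _); ring.
have S12 := leq_frac_add vj (leq_frac_opp S1).
have sumE : (K j * d j) *: (v j).1 -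
    \sum_l (K l * (phi l).1 (v j).1) *: (v l).1 =
    \sum_l (K l * b l) *: (v l).1.
  under [RHS]eq_bigr => l _ do rewrite mulrBr scalerBl.
  rewrite sumrB; congr (_ - _).
  rewrite [RHS](bigD1 j) //= eqxx mul1r big1 ?addr0 // => l /negPf ->.
  by rewrite mul0r mulr0 scale0r.
rewrite sumE in S12.
have [|g [Gg npg gX]] := Gproj (v j) _; first by [].
have gS : in_loc p G (fsum (fun l => fscale (b l, d l) (v l))).
  exists g; split=> //.
  apply: leq_frac_trans (leq_frac_sym S2); first exact: npD.
  by apply: leq_frac_trans S12 => //=; apply: prime_notM.
have [u [npu /= ub]] := Gind (fun l => (b l, d l)) npd gS i.
have pb : p (b i).
  have [[p0 _ _] _ pP] := primep.
  by case: (pP u (b i)) => //; rewrite mulr1 mul0r subr0 in ub; rewrite ub.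
have [idp _ _] := primep.
move: pb; rewrite /b; case: (eqVneq i j) => _ pb.
  split=> // pf; case: (npd i).
  by have [_ pD _] := idp; have := pD _ _ pb pf; rewrite mul1r subrK.
split=> // _; rewrite -[X in p X]opprK -mulN1r; apply: prime_mulr.
by rewrite mul0r sub0r in pb.
Qed.

(** If [f w] is outside [p], the fraction [f / f w] is a splitting, and applying [f] to a relation
    that kills a multiple of [w] shows that the coefficient is zero in the local ring. *)
Lemma p_free_basicP E (w : V) : is_dual_submodule E ->
  p_free_basic p E w <-> exists f, E f /\ ~ p (f w).
Proof.
move=> dualE; split.
  move=> [_ [f [s [Ef nps [u [npu /= e]]]]]]; exists f; split=> // pf.
  have us : u * s = u * f w.
    apply/esym/eqP; rewrite -subr_eq0 -mulrBr; move: e.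
    by rewrite mulr1 mul1r => ->.
  by apply: (prime_notM npu nps); rewrite us; apply: prime_mulr.
move=> [f [Ef npf]]; split.
  move=> a s nps /leq_fracE[u [npu /= e]].
  exists (u * f w); split; first exact: prime_notM.
  have := congr1 f e; rewrite scaler0 mulr1 scalerA (dual0 dualE Ef).
  rewrite (dualZ dualE Ef) => fe.
  by rewrite /= mulr1 mul0r subr0 -fe; ring.
exists f, (f w); split=> //; exists 1; split; first exact: prime_not1.
by rewrite /= mulr1 !mul1r subrr.
Qed.

End Localization.

Lemma exists_free_basic_sum (R : comPzRingType) (M : lmodType R) (N : M -> Prop)
    (X : (R -> Prop) -> Prop) (E : (M -> R) -> Prop) (a : R) (y : M) :
  noetherian_ring R ->
  is_submodule N -> fin_gen_in N ->
  subset_Spec X -> basic_set X ->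
  is_dual_submodule E ->
  (forall p, X p -> exists rk : nat,
      one_plus_dimX_le X p rk /\ free_E_summand_in p E N rk) ->
  N y ->
  (forall p, X p -> ~ p a \/ exists f, E f /\ ~ p (f y)) ->
  exists z, N z /\ X_free_basic X E (y + a *: z).
Proof.
move=> noethR [N0 ND NZ] [s [sN sgen]] specX basicX dualE free Ny ay.
pose m := size s.
(* The element [y] is put last, so that it becomes row [ord_max], the one restricted to multiples of
   [a]. *)
pose h (i : 'I_m.+1) := (rcons s y)`_i.
have hN i : N (h i).
  rewrite /h nth_rcons; case: ltnP => [/sN //|_]; case: eqP => // _.
have hmax : h ord_max = y by rewrite /h nth_rcons ltnn eqxx.
have hgen v : N v -> exists c : 'I_m.+1 -> R, v = \sum_i c i *: h i.
  move=> /sgen[c ->].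
  exists (fun i => if unlift ord_max i is Some j then c j else 0).
  rewrite big_ord_recr /= unlift_none scale0r addr0; apply: eq_bigr => i _.
  have -> : widen_ord (leqnSn m) i = lift ord_max i.
    by apply: val_inj; rewrite /= /bump leqNgt ltn_ord.
  by rewrite liftK /h /= /bump leqNgt ltn_ord /= nth_rcons ltn_ord.
(* Only the values of [E] on the generators [h] matter; they form a submodule of a free module,
   spanned by the rows of [C]. *)
pose W (w : 'rV_m.+1) := exists2 f, E f & w = \row_i f (h i).
have [_ E0 ED EZ] := dualE.
have [k [C [CW CP]]] : exists k (C : 'M[R]_(k, m.+1)), (forall i, W (row i C)) /\
    (forall w, W w -> exists u : 'rV_k, w = u *m C).
  apply: noetherian_row_fin_gen => //.
  - by exists (fun=> 0) => //; apply/rowP => i; rewrite !mxE.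
  - move=> _ _ [f Ef ->] [g Eg ->]; exists (fun v => f v + g v); first exact: ED.
    by apply/rowP => i; rewrite !mxE.
  - move=> r _ [f Ef ->]; exists (fun v => r * f v); first exact: EZ.
    by apply/rowP => i; rewrite !mxE.
have CE f : E f -> exists u : 'I_k -> R, forall i, f (h i) = \sum_j u j * C j i.
  move=> Ef; have [|u uE] := CP (\row_i f (h i)); first by exists f.
  exists (u 0) => i; have := congr1 (fun w : 'rV_m.+1 => w 0 i) uE.
  by rewrite !mxE.
have eC (j : 'I_k) : exists2 f, E f & forall i, C j i = f (h i).
  have [f Ef fE] := CW j; exists f => // i.
  by have := congr1 (fun w : 'rV_m.+1 => w 0 i) fE; rewrite !mxE.
have ideal_dot p (u : 'I_k -> R) i : is_prime_ideal p ->
    ~ p (\sum_j u j * C j i) -> exists j, ~ p (C j i).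
  move=> primep np; apply: contrapT => /forallNP pC; apply: np.
  have [idp _ _] := primep; apply: ideal_sum => // j.
  by apply: prime_mulr => //; apply: contrapT.
have [|p Xp|b bP] := @exists_basic_combination R X noethR specX basicX m k C^T a.
- move=> p Xp; case: (ay p Xp) => [|[f [Ef npf]]]; first by left.
  right; have [u uE] := CE f Ef.
  have [|j npj] := ideal_dot p u ord_max (specX p Xp).
    by rewrite -uE hmax.
  by exists j; rewrite mxE.
(* Modulo [p], the matrix of the values [f j (v i)] is diagonal and invertible of size [rk]. It
   factors through [B] by expanding [v i] in the generators and [f j] in the rows of [C], so [B] has
   rank at least [rk]. *)
- right; have [rk [dimp /free_summand_diag]] := free p Xp.
  case=> [|v [f [vN fE fv]]]; first exact: specX.
  apply: one_plus_dimX_le_mono dimp.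
  have /choice[U UE] := fun i => hgen (v i) (vN i).
  have /choice[Z ZE] := fun i => CE (f i) (fE i).
  have [K [g [gP rkE]]] := rank_atE (specX p Xp).
  rewrite rkE; set B := map_mx g _.
  pose U' : 'M[K]_(rk, m.+1) := \matrix_(i, l) g (U i l).
  pose Z' : 'M[K]_(k, rk) := \matrix_(l, i) g (Z i l).
  have UBZ i j : (U' *m B *m Z') i j = g (f j (v i)).
    rewrite UE (dual_sum dualE (fE j)) rmorph_sum mxE.
    under eq_bigr => l _ do rewrite mxE big_distrl /=.
    rewrite exchange_big /=; apply: eq_bigr => l _.
    rewrite rmorphM ZE rmorph_sum mulr_sumr; apply: eq_bigr => t _.
    by rewrite !mxE rmorphM -mulrA [g (C _ _) * _]mulrC.
  have UBZu : U' *m B *m Z' \in unitmx.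
    have -> : U' *m B *m Z' = diag_mx (\row_i g (f i (v i))).
      apply/matrixP => i j; rewrite UBZ !mxE.
      have [->|ij] := eqVneq i j; first by rewrite mulr1n.
      by rewrite mulr0n; apply/gP/fv; rewrite eq_sym.
    rewrite unitmxE det_diag unitfE; apply/prodf_neq0 => i _.
    by rewrite mxE; apply/eqP => /gP/fv; rewrite eqxx.
  rewrite -(mxrank_unit UBZu); apply: leq_trans (mxrankM_maxl _ _) _.
  exact: mxrankM_maxr.
exists (\sum_i b 0 i *: h i); split.
  by elim/big_ind: _ => // i _; apply: NZ.
move=> p Xp; apply/(p_free_basicP (specX p Xp)) => //.
have [j npj] := bP p Xp; have [f Ef fC] := eC j.
exists f; split=> //; rewrite (dualD dualE Ef) (dualZ dualE Ef).
rewrite (dual_sum dualE Ef) -hmax.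
move: npj; rewrite !mxE fC; under eq_bigr => i _ do rewrite mxE fC.
by [].
Qed.

Unset Implicit Arguments.

Theorem theorem4p5 (R : comPzRingType) (M : lmodType R) (N : M -> Prop)
    (X : (R -> Prop) -> Prop) (E : (M -> R) -> Prop) :
  noetherian_ring R ->
  fin_gen_module M ->
  is_submodule N -> fin_gen_in N ->
  subset_Spec X -> basic_set X ->
  is_dual_submodule E ->
  (forall p, X p -> exists rk : nat,
      one_plus_dimX_le X p rk /\ free_E_summand_in p E N rk) ->
  (exists x, N x /\ X_free_basic X E x) /\
  (forall (a : R) (y : M), N y ->
     X_free_basic X (sum_dual E) ((a, y) : (R^o * M)%type) ->
     exists z, N z /\ X_free_basic X E (y + a *: z)).
Proof.
move=> noethR _ subN fgN specX basicX dualE free.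
have [N0 _ _] := subN.
split=> [|a y Ny ay].
  (* With [a = 1] and [y = 0] the hypothesis on [(a, y)] is automatic, since no prime contains 1. *)
  have [|z [Nz]] := exists_free_basic_sum (a := 1) noethR subN fgN specX
    basicX dualE free N0.
    by move=> p /specX[_ p1 _]; left.
  by rewrite add0r scale1r; exists z.
apply: exists_free_basic_sum => // p Xp.
(* If [a] is in [p], then [c * a + f y] can be outside [p] only through [f y]. *)
have [pa|] := pselect (p a); last by left.
right; have [idp _ _] := specX p Xp.
have [_ [_ [s [[c [f [Ef ->]]] nps [u [npu /= e]]]]]] := ay p Xp.
exists f; split=> // pf; have [_ pD _] := idp.
have [] := prime_notM (specX p Xp) npu nps.
have -> : u * s = u * (c * a + f y).
  apply/esym/eqP; rewrite -subr_eq0 -mulrBr; move: e.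
  by rewrite mulr1 mul1r => ->.
have primep := specX p Xp.
by apply: prime_mulr => //; apply: pD => //; apply: prime_mulr.
Qed.
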